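(* Let $1\leq k\leq\ell<n$ be integers, put $p=k/n$ and $q=\ell/n$, and let $\mathcal F\subseteq\binom{[n]}k$. Then $$\mu_\ell(\partial_{k\to\ell}\mathcal F)\geq \mu_k(\mathcal F)^{\frac{\log q}{\log p}}.$$ If $k<\ell$ and $\mu_k(\mathcal F)=p$, then equality holds in this inequality if and only if $\mathcal F=\{A\in\binom{[n]}k:i\in A\}$ for some $i\in[n]$.
   Context: $[n]=\{1,\ldots,n\}$ and $\binom{[n]}k$ is the collection of all $k$-element subsets of $[n]$. For $\mathcal F\subseteq\binom{[n]}k$, $\mu_k(\mathcal F)=|\mathcal F|/\binom nk$, and for $k\le \ell\le n$ the upper $\ell$-shadow is $\partial_{k\to\ell}\mathcal F=\{B\in\binom{[n]}\ell: A\subseteq B\text{ for some }A\in\mathcal F\}$. Here $\log$ is the natural logarithm. *)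

(* Defs.v *)
From mathcomp Require Import all_boot all_order all_algebra.
From mathcomp Require Import reals exp.

Set Implicit Arguments.
Unset Strict Implicit.
Unset Printing Implicit Defensive.

Import Order.TTheory GRing.Theory Num.Theory.
Local Open Scope ring_scope.

(* The ground set [n] = {1, ..., n} is encoded as 'I_n = {0, ..., n - 1}. *)
Definition layer (n k : nat) : {set {set 'I_n}} := [set A : {set 'I_n} | #|A| == k].

Definition mu (R : realType) (n k : nat) (F : {set {set 'I_n}}) : R :=
  #|F|%:R / 'C(n, k)%:R.

(* The shadow from layer k to layer l; k does not enter the formula, F being
   a family of k-sets wherever this is used. *)
Definition upper_shadow (n l : nat) (F : {set {set 'I_n}}) : {set {set 'I_n}} :=
  [set B in layer n l | [exists A in F, A \subset B]].

(* Main.v *)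
Require Import Defs.
From mathcomp Require Import all_boot all_order all_algebra.
From mathcomp Require Import ring lra.
From mathcomp Require Import unstable interval_inference convex hoelder.
From mathcomp Require Import reals exp.

Set Implicit Arguments.
Unset Strict Implicit.
Unset Printing Implicit Defensive.

Import Order.TTheory GRing.Theory Num.Theory.
Local Open Scope ring_scope.

(* The exponents multiply along k -> k+1 -> ... -> l, so it is enough to treat
   l = k + 1. The Lovasz form of Kruskal-Katona is used in Keevash's shape: if
   G consists of r-sets and |G| <= C(x, r) with x real, then at most
   (x - r) |G| / (r + 1) sets of size r + 1 have all their r-subsets in G. This
   follows by induction on r, bounding the cliques through a vertex v both by
   the cliques of the link of v and by the number of sets of G avoiding v.

   If mu(F) >= p, apply it to the complement of F in its layer, with
   x = n - mu(F) / p; two Bernoulli inequalities finish. If mu(F) = p ^ s with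
   s >= 1, apply it to the complements of the members of the shadow, with
   x = n - (k + 1) (1 - (k / (k + 1)) ^ s): if the shadow had density
   u < q ^ s, then mu(F) <= u (p / q) ^ s < p ^ s. For extremal F the first case
   is tight with x = n - 1, so every vertex has degree 0 or C(n - 2, k - 1) in
   the complement of F; some vertex has degree 0, and F contains its star. *)

(** * Cliques, links and stars of a uniform family *)

Section Cliques.
Variable T : finType.
Implicit Types (G : {set {set T}}) (A B : {set T}) (v : T).

(** For [r = 2] these are the triangles of the graph [G]. *)
Definition cliques (r : nat) G : {set {set T}} :=
  [set B : {set T} | (#|B| == r.+1) && [forall x in B, B :\ x \in G]].

Definition link v G : {set {set T}} :=
  [set A : {set T} | (v \notin A) && (v |: A \in G)].

Definition star v G : {set {set T}} := [set A in G | v \in A].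

Lemma sum_card_star r G :
  (forall A, A \in G -> #|A| = r) -> (\sum_v #|star v G| = r * #|G|)%N.
Proof.
move=> Gr; transitivity (\sum_v \sum_(A in G) (v \in A))%N.
  apply: eq_bigr => v _; rewrite -sum1_card big_mkcond [RHS]big_mkcond /=.
  by apply: eq_bigr => A _; rewrite inE; case: (A \in G); case: (v \in A).
rewrite exchange_big /= mulnC -sum_nat_const; apply: eq_bigr => A AG.
by rewrite -(Gr A AG) -sum1_card [RHS]big_mkcond; apply: eq_bigr => v _; case: ifP.
Qed.

Lemma card_cliques r G B : B \in cliques r G -> #|B| = r.+1.
Proof. by rewrite inE => /andP[/eqP]. Qed.

Lemma setD1_inj v : {in [pred A : {set T} | v \in A] &, injective (fun A => A :\ v)}.
Proof. by move=> A B vA vB eqAB; rewrite -(setD1K vA) -(setD1K vB) eqAB. Qed.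

Lemma card_link v G : #|link v G| = #|star v G|.
Proof.
have -> : link v G = (fun A => A :\ v) @: star v G.
  apply/setP=> A; apply/idP/imsetP => [|[B]]; rewrite inE => /andP[].
    by move=> vA GA; exists (v |: A); rewrite ?inE ?GA ?eqxx // setU1K.
  by move=> BG vB ->; rewrite inE !inE eqxx setD1K.
by rewrite card_in_imset // => A B; rewrite !inE => /andP[_ ?] /andP[_ ?]; exact: setD1_inj.
Qed.

Lemma card_in_link r v G : (forall A, A \in G -> #|A| = r.+1) ->
  forall A, A \in link v G -> #|A| = r.
Proof.
by move=> Gr A; rewrite inE => /andP[vA /Gr]; rewrite cardsU1 vA => -[].
Qed.

(** Deleting [v] is injective on cliques through [v], and each facet of [B :\ v] becomes a facet of
    [B] once [v] is put back. *)
Lemma star_cliques_le_link r v G :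
  (#|star v (cliques r.+1 G)| <= #|cliques r (link v G)|)%N.
Proof.
rewrite -(@card_in_imset _ _ (fun A => A :\ v) (mem (star v (cliques r.+1 G)))); last first.
  by move=> A B; rewrite !inE => /andP[_ ?] /andP[_ ?]; exact: setD1_inj.
apply/subset_leq_card/subsetP => _ /imsetP[B + ->].
rewrite !inE => /andP[/andP[cardB /forall_inP BG] vB].
move: cardB; rewrite (cardsD1 v) vB eqSS => -> /=.
apply/forall_inP => x; rewrite !inE => /andP[xv xB].
have -> : v |: B :\ v :\ x = B :\ x.
  by apply/setP => y; rewrite !inE; case: (eqVneq y v) => // ->; rewrite vB eq_sym xv.
by rewrite eqxx andbF BG.
Qed.

(** A clique [B] through [v] is recovered from its facet [B :\ v], a member of [G] outside
    [star v G]. *)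
Lemma star_cliques_le r v G :
  (#|star v (cliques r G)| + #|star v G| <= #|G|)%N.
Proof.
rewrite -(@card_in_imset _ _ (fun A => A :\ v) (mem (star v (cliques r G)))); last first.
  by move=> A B; rewrite !inE => /andP[_ ?] /andP[_ ?]; exact: setD1_inj.
set D := imset _ _.
have DG : D \subset G :\: star v G.
  apply/subsetP => _ /imsetP[B + ->].
  rewrite !inE => /andP[/andP[_ /forall_inP BG] vB].
  by rewrite eqxx andbF /= BG.
have sG : star v G \subset G by apply/subsetP => A; rewrite inE => /andP[].
move: (subset_leq_card DG); rewrite cardsD (setIidPr sG) => le.
by rewrite -(subnK (subset_leq_card sG)) leq_add2r.
Qed.

End Cliques.

(** * The clique bound with a real parameter *)

Section Keevash.
Variables (R : realFieldType) (T : finType).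
Implicit Types (G : {set {set T}}) (v : T).

(** This is r! C(x, r) for real x; sizes are compared with C(x, r) after multiplication by r!. *)
Definition falling (x : R) (r : nat) : R := \prod_(i < r) (x - i%:R).

Lemma fallingS x r : falling x r.+1 = x * falling (x - 1) r.
Proof.
rewrite /falling big_ord_recl /= subr0; congr (_ * _); apply: eq_bigr => i _.
by rewrite /bump /= natrD /=; ring.
Qed.

Lemma falling0 (x : R) : falling x 0 = 1.
Proof. by rewrite /falling big_ord0. Qed.

Lemma fallingSr (x : R) r : falling x r.+1 = falling x r * (x - r%:R).
Proof. by rewrite /falling big_ord_recr. Qed.

Lemma falling_gt0 (x : R) r : r%:R - 1 < x -> 0 < falling x r.
Proof.
move=> rx; apply: prodr_gt0 => i _; rewrite subr_gt0; apply: le_lt_trans rx.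
by rewrite lerBrDr natr1 ler_nat.
Qed.

Lemma falling_nat m r : falling m%:R r = (m ^_ r)%:R.
Proof.
elim: r m => [|r IH] m; first by rewrite /falling big_ord0.
rewrite fallingS ffactnS natrM; case: m => [|m]; first by rewrite !mul0r.
by rewrite -IH; congr (_ * falling _ _); rewrite -natr1; ring.
Qed.

Lemma sum_natr_card_star r G (a : R) : (forall A, A \in G -> #|A| = r) ->
  \sum_v a * #|star v G|%:R = r%:R * (a * #|G|%:R).
Proof.
by move=> Gr; rewrite -mulr_sumr -natr_sum (sum_card_star Gr) natrM mulrCA.
Qed.

Lemma ltr_sum_one (I : finType) (E1 E2 : I -> R) i :
  (forall j, E1 j <= E2 j) -> E1 i < E2 i -> \sum_j E1 j < \sum_j E2 j.
Proof.
move=> le12 lt12; rewrite (bigD1 i) //= [ltRHS](bigD1 i) //=.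
by apply: ltr_leD lt12 _; apply: ler_sum.
Qed.

(* For a family [G] of [r]-sets with [#|G| <= 'C(x, r)], [x] real, this bounds
   [#|cliques r G|] by [#|G| * 'C(x, r.+1) / 'C(x, r)], strictly if
   [0 < #|G| < 'C(x, r)]; Keevash's bound has [#|G| = 'C(x, r)]. Allowing
   inequality lets the induction use [x - 1] in every link. *)
Definition cliques_le r := forall (x : R) G, r%:R - 1 <= x ->
  (forall A, A \in G -> #|A| = r) ->
  #|G|%:R * r`!%:R <= falling x r ->
  r.+1%:R * #|cliques r G|%:R <= (x - r%:R) * #|G|%:R /\
  ((0 < #|G|)%N -> #|G|%:R * r`!%:R < falling x r ->
    r.+1%:R * #|cliques r G|%:R < (x - r%:R) * #|G|%:R).

(** Local form of the clique bound, to be summed over [v]. A degree below C(x - 1, r) is handled by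
    induction in the link, a larger one by [star_cliques_le]. The second way to get strictness
    serves the equality case: it makes a tight family have only degrees 0 and C(x - 1, r). *)
Lemma star_cliques_bound r x G v : ((0 < r)%N -> cliques_le r) ->
  r%:R <= x -> (forall A, A \in G -> #|A| = r.+1) ->
  #|G|%:R * r.+1`!%:R <= falling x r.+1 ->
  r.+1%:R * #|star v (cliques r.+1 G)|%:R <= (x - r.+1%:R) * #|star v G|%:R
  /\ ((0 < #|star v G|)%N ->
      #|G|%:R * r.+1`!%:R < falling x r.+1
        \/ #|star v G|%:R * r`!%:R != falling (x - 1) r ->
    r.+1%:R * #|star v (cliques r.+1 G)|%:R < (x - r.+1%:R) * #|star v G|%:R).
Proof.
move=> IH rx Gr Gx.
have Kl := star_cliques_le_link r v G.
have KG := star_cliques_le r.+1 v G.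
move: (card_link v G) (card_in_link Gr (v := v)) => cl lr.
have rf : (0 : R) < r`!%:R by rewrite ltr0n fact_gt0.
have sG : (#|star v G| <= #|G|)%N by apply: leq_trans KG; rewrite leq_addl.
have x0 : 0 <= x by apply: le_trans rx.
(* A large degree leaves few sets avoiding [v], and a clique through [v] is
   determined by its facet avoiding [v]. *)
have big : (0 < #|star v G|)%N -> falling (x - 1) r <= #|star v G|%:R * r`!%:R ->
  r.+1%:R * #|star v (cliques r.+1 G)|%:R <= (x - r.+1%:R) * #|star v G|%:R /\
  (#|G|%:R * r.+1`!%:R < falling x r.+1
        \/ #|star v G|%:R * r`!%:R != falling (x - 1) r ->
    r.+1%:R * #|star v (cliques r.+1 G)|%:R < (x - r.+1%:R) * #|star v G|%:R).
  move=> d0 dx.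
  have dR : (0 : R) < #|star v G|%:R by rewrite ltr0n.
  have KGR : #|star v (cliques r.+1 G)|%:R + #|star v G|%:R <= #|G|%:R :> R.
    by rewrite -natrD ler_nat.
  have r1 : (0 : R) < r.+1%:R by rewrite ltr0n.
  have G0 : (0 : R) < #|G|%:R * r.+1`!%:R.
    by rewrite mulr_gt0 // ltr0n ?fact_gt0 // (leq_trans d0).
  have xp : 0 < x.
    rewrite lt_def x0 andbT; apply: contraTneq (lt_le_trans G0 Gx) => ->.
    by rewrite fallingS mul0r ltxx.
  have step : r.+1%:R * #|star v (cliques r.+1 G)|%:R <=
      r.+1%:R * #|G|%:R - r.+1%:R * #|star v G|%:R :> R.
    by rewrite -mulrBr ler_pM2l // lerBrDr.
  have eqG : #|G|%:R * r.+1`!%:R = (r.+1%:R * #|G|%:R) * r`!%:R :> R.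
    by rewrite factS natrM; ring.
  split=> [|strict].
    apply: le_trans step _; rewrite mulrBl lerD2r -(ler_pM2r rf) -eqG.
    by apply: le_trans Gx _; rewrite fallingS -mulrA ler_pM2l.
  apply: le_lt_trans step _; rewrite mulrBl ltrD2r -(ltr_pM2r rf) -eqG.
  case: strict => strict.
    by apply: lt_le_trans strict _; rewrite fallingS -mulrA ler_pM2l.
  apply: le_lt_trans Gx _; rewrite fallingS -mulrA ltr_pM2l //.
  by rewrite lt_def strict.
have [d0|d0] := posnP #|star v G|.
  rewrite d0 mulr0; split=> //.
  have -> : #|star v (cliques r.+1 G)| = 0%N; last by rewrite mulr0.
  apply/eqP; rewrite cards_eq0; apply/eqP/setP => B; rewrite !inE.
  apply/negP => /andP[/andP[/eqP cB /forall_inP BG] vB].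
  (* A clique has at least two points, so removing some [w] other than [v] leaves a member of [G]
     through [v], against degree 0. *)
  have /set0Pn[w] : B :\ v != set0.
    by rewrite -card_gt0; move: cB; rewrite (cardsD1 v) vB add1n => -[->].
  rewrite !inE => /andP[wv wB].
  move/eqP: d0; rewrite cards_eq0 => /eqP/setP/(_ (B :\ w)).
  by rewrite !inE BG // eq_sym wv vB.
have [small|/(big d0)[? ?]] := ltP (#|star v G|%:R * r`!%:R) (falling (x - 1) r); last by [].
(* For [r = 0] a small degree would be below the empty product 1, yet it is positive. *)
case: r => [|r] in IH rx Gr Gx Kl KG lr rf small big *.
  move: small; rewrite fact0 mulr1 /falling big_ord0 ltNge.
  by rewrite -[1]/(1%:R) ler_nat d0.
(* The link drops both the set size and x by one, so its coefficient x - 1 - (r + 1) is exactly the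
   required x - (r + 2). *)
have rx' : r.+1%:R - 1 <= x - 1 by rewrite lerD2r.
have [|_] := IH isT (x - 1) (link v G) rx' lr; first by rewrite cl ltW.
rewrite cl => /(_ d0 small) lt.
have {}lt : r.+2%:R * #|star v (cliques r.+2 G)|%:R < (x - r.+2%:R) * #|star v G|%:R.
  apply: le_lt_trans (_ : r.+2%:R * #|cliques r.+1 (link v G)|%:R < _).
    by rewrite ler_pM2l ?ltr0n // ler_nat.
  apply: lt_le_trans lt _.
  by rewrite -(natr1 r.+1) opprD addrA addrAC.
by split=> [|_ _]; [exact: ltW|].
Qed.

(** Summed over the vertices, the local bounds count each member of [G] r + 1 times and each clique
    r + 2 times, where r + 1 is the size of the members. One vertex of positive degree is enough for
    strictness. *)
Lemma cliques_bound r : (0 < r)%N -> cliques_le r.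
Proof.
elim: r => // r IH _ x G rx Gr Gx.
have {}rx : r%:R <= x by move: rx; rewrite -natr1 addrK.
have loc v := star_cliques_bound v IH rx Gr Gx.
have Kr A : A \in cliques r.+1 G -> #|A| = r.+2 by exact: card_cliques.
have r1 : (0 : R) < r.+1%:R by rewrite ltr0n.
have sumG := sum_natr_card_star (x - r.+1%:R) Gr.
have sumK := sum_natr_card_star r.+1%:R Kr; rewrite mulrCA in sumK.
split=> [|G0 Gx'].
  by rewrite -(ler_pM2l r1) -sumK -sumG; apply: ler_sum => v _; case: (loc v).
rewrite -(ltr_pM2l r1) -sumK -sumG.
have /card_gt0P[A AG] := G0.
have /card_gt0P[v vA] : (0 < #|A|)%N by rewrite (Gr A AG).
apply: (@ltr_sum_one _ _ _ v) => [w|]; first by case: (loc w).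
case: (loc v) => _; apply; last by left.
by apply/card_gt0P; exists A; rewrite inE AG.
Qed.

(** Any other degree would make the local bound at [v] strict, and with it the sum over all
    vertices. *)
Lemma cliques_bound_eq r x G : r%:R <= x ->
  (forall A, A \in G -> #|A| = r.+1) ->
  #|G|%:R * r.+1`!%:R <= falling x r.+1 ->
  (x - r.+1%:R) * #|G|%:R <= r.+2%:R * #|cliques r.+1 G|%:R ->
  forall v, #|star v G| = 0%N \/ #|star v G|%:R * r`!%:R = falling (x - 1) r.
Proof.
move=> rx Gr Gx.
have loc v := star_cliques_bound v (fun r0 => @cliques_bound r r0) rx Gr Gx.
have Kr A : A \in cliques r.+1 G -> #|A| = r.+2 by exact: card_cliques.
have r1 : (0 : R) < r.+1%:R by rewrite ltr0n.
rewrite leNgt => + v; move/negP => nlt.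
have [|d0] := posnP #|star v G|; [by left|right].
apply/eqP/negPn/negP => ne; apply: nlt.
rewrite -(ltr_pM2l r1) -(sum_natr_card_star _ Gr) mulrCA -(sum_natr_card_star _ Kr).
apply: (@ltr_sum_one _ _ _ v) => [w|]; first by case: (loc w).
by case: (loc v) => _; apply=> //; right.
Qed.

End Keevash.

(** * Convexity of powers and estimates of falling factorials *)

Section Powers.
Variable R : realType.

Lemma powR_ln_div (p q : R) : 0 < p < 1 -> 0 < q -> p `^ (ln q / ln p) = q.
Proof.
move=> /andP[p0 p1] q0; rewrite /powR gt_eqF // divfK ?lnK //.
by rewrite lt_eqF // ln_lt0 // p0.
Qed.

(** Convexity of the power function between [w] and 1. *)
Lemma powR_conv1 (s w r : R) : 1 <= r -> 0 <= w -> 0 <= s <= 1 ->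
  (1 - s + s * w) `^ r <= 1 - s + s * w `^ r.
Proof.
move=> r1 w0 s01; have := @convex_powR R r r1 (Itv01 (andP s01).1 (andP s01).2) w 1.
rewrite !classical_sets.inE /= !in_itv /= w0 ler01 [leRHS]convRE /= /onem powR1 mulr1.
move=> /(_ isT isT); rewrite [X in X `^ _ <= _ -> _]convRE /= mulr1.
by rewrite ![1 - s + _]addrC.
Qed.

(** Convexity of exp between [ln a] and 0. *)
Lemma powR_le_bernoulli (a s : R) : 0 < a -> 0 <= s <= 1 ->
  a `^ s <= 1 + s * (a - 1).
Proof.
move=> a0 s01; have := @convex_expR R (Itv01 (andP s01).1 (andP s01).2) (ln a) 0.
rewrite !convRE /= /onem mulr0 addr0 expR0 mulr1 lnK ?posrE // /powR gt_eqF //.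
by move/le_trans; apply; rewrite le_eqVlt; apply/orP; left; apply/eqP; ring.
Qed.

(** Passing from r to r + 1 costs only r d (d - 1) >= 0. With x = n and r d = n m it says that C(n -
    d, r) is at least (1 - m) C(n, r), so that n - d is a valid parameter for a family of density 1
    - m. *)
Lemma falling_sub_ge_linear (x d : R) r : 1 <= d -> r%:R - 1 <= x - d ->
  (x - r%:R * d) * falling x r <= x * falling (x - d) r.
Proof.
move=> d1; elim: r => [|r IH] rx; first by rewrite !falling0 mul0r subr0.
have {}rx : r%:R <= x - d by move: rx; rewrite -natr1 addrK.
have {}IH := IH (le_trans (ltW _) rx).
have fx : 0 < falling x r by apply: falling_gt0; lra.
have r0 : 0 <= r%:R :> R by [].
have /IH{}IH : r%:R - 1 < r%:R :> R by rewrite ltrBlDr ltrDl ltr01.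
rewrite !fallingSr mulrA.
have {}IH : (x - r%:R * d) * falling x r * (x - d - r%:R)
          <= x * falling (x - d) r * (x - d - r%:R) by rewrite ler_wpM2r // subr_ge0.
rewrite [leRHS]mulrA; apply: le_trans IH; rewrite mulrAC [leRHS]mulrAC.
rewrite ler_pM2r // -natr1 -subr_ge0.
have -> : (x - r%:R * d) * (x - d - r%:R) - (x - (r%:R + 1) * d) * (x - r%:R)
   = r%:R * d * (d - 1) by ring.
by rewrite !mulr_ge0 ?subr_ge0 // (le_trans ler01).
Qed.

(** Since (n - r) / n is the product of the 1 - 1 / (n - i) over i < r, both sides are products of r
    factors and can be compared factor by factor. *)
Lemma falling_sub_ge_powR (n a : R) (s : R) r : 1 <= s -> 1 <= a ->
  r%:R <= n - a ->
  ((n - r%:R) / n) `^ s * falling n r <=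
  falling (n - a * (1 - (1 - a^-1) `^ s)) r.
Proof.
move=> s1 a1; have a0 : 0 < a by apply: lt_le_trans a1.
elim: r => [|r IH] rn.
  rewrite !falling0 subr0 divff ?powR1 ?mulr1 //.
  by rewrite gt_eqF // (lt_le_trans a0) // -subr_ge0.
rewrite -natr1 in rn.
have {}IH := IH ltac:(lra).
set w := (1 - a^-1) `^ s in IH *.
have b0 : 0 < n - r%:R by lra.
have n0 : 0 < n by have : 0 <= r%:R :> R by []; lra.
have c0 : 0 <= 1 - (n - r%:R)^-1 by rewrite subr_ge0 invf_le1 //; lra.
rewrite !fallingSr -natr1.
have -> : (n - (r%:R + 1)) / n = (n - r%:R) / n * (1 - (n - r%:R)^-1).
  by field; rewrite !gt_eqF.
rewrite powRM ?divr_ge0 ?(ltW b0) ?(ltW n0) //.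
(* With b = n - r >= a, the number 1 - 1 / b is the mean of 1 and 1 - 1 / a with weight a / b on the
   latter; convexity of the s-th power applies. *)
have cw : (1 - (n - r%:R)^-1) `^ s * (n - r%:R) <= n - a * (1 - w) - r%:R.
  rewrite -ler_pdivlMr //.
  have -> : (n - a * (1 - w) - r%:R) / (n - r%:R) =
      1 - a / (n - r%:R) + a / (n - r%:R) * w by field; rewrite gt_eqF.
  have -> : 1 - (n - r%:R)^-1 = 1 - a / (n - r%:R) + a / (n - r%:R) * (1 - a^-1).
    by field; rewrite !gt_eqF.
  apply: powR_conv1 => //; first by rewrite subr_ge0 invf_le1.
  by rewrite divr_ge0 ?(ltW a0) ?(ltW b0) //= ler_pdivrMr // mul1r; lra.
rewrite mulrACA; apply: ler_pM => //.
  by rewrite mulr_ge0 ?powR_ge0 // ltW // falling_gt0 //; lra.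
by rewrite mulr_ge0 ?powR_ge0 // ltW.
Qed.

End Powers.

(** * Shadows in the next layer *)

Section Shadows.
Variables (R : realType) (n : nat).
Implicit Types (F : {set {set 'I_n}}) (k l : nat).
Local Notation mu := (mu R).

Lemma card_layer k : #|layer n k| = 'C(n, k).
Proof. by rewrite /layer card_draws card_ord. Qed.

Lemma card_layerD k F : F \subset layer n k ->
  #|layer n k :\: F| = ('C(n, k) - #|F|)%N.
Proof. by move=> Fk; rewrite cardsD (setIidPr Fk) card_layer. Qed.

Lemma upper_shadow_sub l F : upper_shadow l F \subset layer n l.
Proof. by apply/subsetP => B; rewrite inE => /andP[]. Qed.

Lemma layerD_shadow_cliques k F :
  layer n k.+1 :\: upper_shadow k.+1 F \subset cliques k (layer n k :\: F).
Proof.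
apply/subsetP => B; rewrite !inE => /andP[+ cB]; rewrite cB /=.
move/exists_inPn => nF; apply/forall_inP => x xB; rewrite !inE.
move: cB; rewrite (cardsD1 x) xB eqSS => ->; rewrite andbT.
by apply/negP => /nF; rewrite subsetDl.
Qed.

(** The facets of [~: A] are the complements of the sets [x |: A] with x outside [A], all of which
    lie in the shadow. *)
Lemma setC_cliques k F : (k < n)%N -> F \subset layer n k ->
  @setC _ @: F \subset cliques (n - k.+1) (@setC _ @: upper_shadow k.+1 F).
Proof.
move=> kn /subsetP Fk; apply/subsetP => _ /imsetP[A AF ->].
have := Fk _ AF; rewrite !inE => /eqP cA.
have cC : #|~: A| = (n - k)%N by rewrite cardsCs setCK card_ord cA.
rewrite cC subnSK ?eqxx //; apply/forall_inP => x; rewrite inE => xA.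
apply/imsetP; exists (x |: A); last by rewrite setCU setIC setDE.
by rewrite !inE cardsU1 xA cA eqxx; apply/exists_inP; exists A; rewrite ?subsetU1.
Qed.

Lemma mu_ge0 k F : 0 <= mu k F.
Proof. exact: divr_ge0. Qed.

Lemma bin_neq0 k : (k <= n)%N -> 'C(n, k)%:R != 0 :> R.
Proof. by move=> kn; rewrite pnatr_eq0 -lt0n bin_gt0. Qed.

Lemma card_mu k F : (k <= n)%N -> #|F|%:R = mu k F * 'C(n, k)%:R.
Proof. by move=> kn; rewrite divfK ?bin_neq0. Qed.

Lemma mu_le1 k F : (k <= n)%N -> F \subset layer n k -> mu k F <= 1.
Proof.
move=> kn /subset_leq_card; rewrite card_layer => le.
by rewrite ler_pdivrMr ?mul1r ?ler_nat // ltr0n bin_gt0.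
Qed.

Lemma card_layerD_mu k F : (k <= n)%N -> F \subset layer n k ->
  #|layer n k :\: F|%:R = (1 - mu k F) * 'C(n, k)%:R.
Proof.
move=> kn Fk; rewrite card_layerD // natrB.
  by rewrite mulrBl mul1r -card_mu.
by rewrite -card_layer subset_leq_card.
Qed.

Lemma natr_mul_bin_left k : (k <= n)%N ->
  k.+1%:R * 'C(n, k.+1)%:R = (n%:R - k%:R) * 'C(n, k)%:R :> R.
Proof. by move=> kn; rewrite -natrM mul_bin_left natrM natrB. Qed.

Lemma natr_bin_ffact k : 'C(n, k)%:R * k`!%:R = falling n%:R k :> R.
Proof. by rewrite -natrM bin_ffact falling_nat. Qed.

Lemma in_layerD k F A : A \in layer n k :\: F -> #|A| = k.
Proof. by rewrite !inE => /andP[_ /eqP]. Qed.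

Lemma mu_shadow_large k F : (0 < k < n)%N -> F \subset layer n k ->
  k%:R / n%:R <= mu k F ->
  (1 - mu k.+1 (upper_shadow k.+1 F)) * (n%:R - k%:R) <=
  (1 - mu k F) * (n%:R - k%:R - n%:R * mu k F / k%:R).
Proof.
move=> /andP[k0 kn] Fk pF.
have kR : (0 : R) < k%:R by rewrite ltr0n.
have knR : k.+1%:R <= n%:R :> R by rewrite ler_nat.
have nR : (0 : R) < n%:R by rewrite ltr0n (leq_trans _ kn).
have F1 := mu_le1 (ltnW kn) Fk.
set d := n%:R * mu k F / k%:R.
have d1 : 1 <= d by rewrite ler_pdivlMr // mul1r mulrC -ler_pdivrMr.
have dn : d <= n%:R / k%:R.
  by rewrite ler_pM2r ?invr_gt0 // ler_piMr // ltW.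
have kd : k%:R * d = n%:R * mu k F by rewrite mulrC divfK ?gt_eqF.
(* After multiplication by k the difference of the two sides is n (1 - mu) + (n - k) (k - 1). *)
have kx : k%:R - 1 <= n%:R - d.
  rewrite -(ler_pM2l kR) [leRHS]mulrBr kd.
  have k1 : (1 : R) <= k%:R by rewrite ler1n.
  have : 0 <= n%:R * (1 - mu k F) by rewrite mulr_ge0 ?subr_ge0 // ltW.
  have : 0 <= (n%:R - k%:R) * (k%:R - 1) :> R.
    by rewrite mulr_ge0 ?subr_ge0 // ler_nat ltnW.
  nra.
have [|le _] := cliques_bound k0 kx (@in_layerD k F).
  rewrite card_layerD_mu ?(ltnW kn) // -mulrA natr_bin_ffact -(ler_pM2l nR).
  apply: le_trans (falling_sub_ge_linear d1 kx).
  by rewrite kd mulrA mulrBr mulr1.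
have := subset_leq_card (layerD_shadow_cliques k F).
rewrite -(ler_nat R) card_layerD_mu ?upper_shadow_sub //.
rewrite -(ler_pM2l (_ : 0 < k.+1%:R)) ?ltr0n // mulrCA natr_mul_bin_left ?(ltnW kn) //.
move=> /le_trans/(_ le); rewrite card_layerD_mu ?(ltnW kn) //.
rewrite mulrA [leRHS]mulrA ler_pM2r ?ltr0n ?bin_gt0 ?(ltnW kn) //.
by rewrite [leRHS]mulrC [n%:R - d - _]addrAC.
Qed.

Lemma mu_shadow_small k F (s : R) : (0 < k)%N -> (k.+1 < n)%N ->
  F \subset layer n k -> 1 <= s ->
  mu k.+1 (upper_shadow k.+1 F) <= (k.+1%:R / n%:R) `^ s ->
  mu k F <= mu k.+1 (upper_shadow k.+1 F) * (k%:R / k.+1%:R) `^ s.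
Proof.
move=> k0 kn Fk s1 Us.
have kn' := ltnW kn; have kn'' := ltnW kn'.
set r := (n - k.+1)%N.
have r0 : (0 < r)%N by rewrite subn_gt0.
have rR : r%:R = n%:R - k.+1%:R :> R by rewrite natrB.
pose a : R := k.+1%:R.
have a1 : 1 <= a by rewrite ler1n.
have a0 : 0 < a by apply: lt_le_trans a1.
have ka : k%:R / a = 1 - a^-1.
  by rewrite /a -natr1; field; rewrite natr1 gt_eqF.
set G := @setC _ @: upper_shadow k.+1 F.
have Gr A : A \in G -> #|A| = r.
  case/imsetP => B + ->; rewrite inE => /andP[]; rewrite inE => /eqP cB _.
  by rewrite cardsCs setCK card_ord cB.
have cG : #|G| = #|upper_shadow k.+1 F| by rewrite card_imset //; exact: setC_inj.
set w := (k%:R / k.+1%:R) `^ s.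
have w1 : w <= 1.
  have -> : 1 = 1 `^ s :> R by rewrite powR1.
  rewrite ge0_ler_powR ?nnegrE ?(le_trans ler01 s1) ?divr_ge0 //.
  by rewrite ler_pdivrMr // mul1r ler_nat.
(* The parameter x = n - (k + 1) (1 - w) has x - r = (k + 1) w, which puts the factor [w] into the
   conclusion. *)
have rx : r%:R - 1 <= n%:R - a * (1 - w).
  have : 0 <= a * w by rewrite mulr_ge0 ?powR_ge0 // ltW.
  by rewrite rR mulrBr mulr1 /a; lra.
have [|le _] := cliques_bound r0 rx Gr.
  rewrite cG (card_mu _ kn') -(bin_sub kn') -mulrA natr_bin_ffact.
  apply: le_trans (_ : ((n%:R - r%:R) / n%:R) `^ s * falling n%:R r <= _).
    rewrite ler_pM2r; first by rewrite rR opprB addrCA subrr addr0.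
    by rewrite falling_gt0 // rR; have : 0 <= k.+1%:R :> R by []; lra.
  by rewrite /w ka; apply: falling_sub_ge_powR => //; rewrite rR.
have cF : #|@setC _ @: F| = #|F| by rewrite card_imset //; exact: setC_inj.
have := subset_leq_card (setC_cliques kn' Fk).
rewrite cF -(ler_nat R) -(ler_pM2l (_ : 0 < r.+1%:R)) ?ltr0n //.
move=> /le_trans/(_ le); rewrite cG (card_mu F kn'') (card_mu _ kn') rR.
have -> : r.+1%:R = n%:R - k%:R :> R by rewrite /r subnSK // natrB.
rewrite mulrCA -natr_mul_bin_left // => {}le.
have : k.+1%:R * 'C(n, k.+1)%:R * mu k F <=
    k.+1%:R * 'C(n, k.+1)%:R * (mu k.+1 (upper_shadow k.+1 F) * w).
  rewrite mulrC (le_trans le) // le_eqVlt; apply/orP; left; apply/eqP.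
  by rewrite -/a; ring.
by rewrite ler_pM2l // mulr_gt0 ?ltr0n ?bin_gt0.
Qed.

Lemma mu_shadow_step k F : (0 < k)%N -> (k.+1 < n)%N -> F \subset layer n k ->
  mu k F `^ (ln (k.+1%:R / n%:R) / ln (k%:R / n%:R)) <=
  mu k.+1 (upper_shadow k.+1 F).
Proof.
move=> k0 kn Fk.
set p := k%:R / n%:R; set q := k.+1%:R / n%:R; set t := ln q / ln p.
have kR : (0 : R) < k%:R by rewrite ltr0n.
have nR : (0 : R) < n%:R by rewrite ltr0n (leq_trans _ kn).
have knR : k.+1%:R < n%:R :> R by rewrite ltr_nat.
have p0 : 0 < p by rewrite divr_gt0.
have q0 : 0 < q by rewrite divr_gt0.
have p1 : p < 1 by rewrite ltr_pdivrMr // mul1r ltr_nat ltnW.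
have q1 : q < 1 by rewrite ltr_pdivrMr // mul1r.
have lp : ln p < 0 by rewrite ln_lt0 // p0.
have lq : ln q < 0 by rewrite ln_lt0 // q0.
have pt : p `^ t = q by rewrite powR_ln_div ?p0.
(* Zero to the power zero is 1 for [powR], so the empty family relies on the exponent being
   nonzero. *)
have [m0|m0] := eqVneq (mu k F) 0.
  by rewrite m0 powR0 ?mu_ge0 // mulf_neq0 ?invr_eq0 ?lt_eqF.
have {}m0 : 0 < mu k F by rewrite lt_def m0 mu_ge0.
have m1 := mu_le1 (ltnW (ltnW kn)) Fk.
pose s := ln (mu k F) / ln p.
have ps : p `^ s = mu k F by rewrite powR_ln_div ?p0.
have s0 : 0 <= s by apply: mulr_le0; [exact: ln_le0 | rewrite invr_le0 ltW].
have mt : mu k F `^ t = q `^ s by rewrite -ps powRAC pt.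
have qp : q / p = k.+1%:R / k%:R by rewrite /q /p; field; rewrite !gt_eqF.
rewrite mt; have [pm|mp] := leP p (mu k F).
  have s1 : s <= 1.
    by rewrite ler_ndivrMr // mul1r ler_ln ?posrE.
  have le_mu := @mu_shadow_large k F ltac:(by rewrite k0 ltnW) Fk pm.
  have nk : 0 < n%:R - k%:R :> R by rewrite subr_gt0 ltr_nat ltnW.
  have s01 : 0 <= s <= 1 by rewrite s0.
  have bp := powR_le_bernoulli p0 s01; rewrite ps in bp.
  have bq := powR_le_bernoulli (divr_gt0 q0 p0) s01.
  have -> : q = p * (q / p) by rewrite mulrCA divff ?mulr1 // gt_eqF.
  rewrite powRM ?divr_ge0 ?(ltW p0) ?(ltW q0) // ps.
  apply: le_trans (_ : mu k F * (1 + s / k%:R) <= _).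
    rewrite ler_pM2l // (le_trans bq) // qp -natr1.
    by rewrite le_eqVlt; apply/orP; left; apply/eqP; field; rewrite gt_eqF.
  (* By [le_mu], the density of the shadow times n - k is at least mu (n - k) + (mu / k) (1 - mu) n,
     so this inequality suffices. It is Bernoulli at p: 1 - p^s >= s (1 - p). *)
  have ms : s * (n%:R - k%:R) <= (1 - mu k F) * n%:R.
    have -> : n%:R - k%:R = (1 - p) * n%:R by rewrite /p; field; rewrite gt_eqF.
    by rewrite mulrA ler_pM2r //; lra.
  rewrite -(ler_pM2r nk).
  have mk0 : 0 <= mu k F / k%:R by rewrite divr_ge0 ?mu_ge0.
  have {}ms := ler_wpM2l mk0 ms.
  have e1 : mu k F * (1 + s / k%:R) * (n%:R - k%:R) =
    mu k F * (n%:R - k%:R) + mu k F / k%:R * (s * (n%:R - k%:R)) by ring.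
  have e2 : (1 - mu k F) * (n%:R - k%:R - n%:R * mu k F / k%:R) =
    (n%:R - k%:R) - mu k F * (n%:R - k%:R) - mu k F / k%:R * ((1 - mu k F) * n%:R) by ring.
  rewrite e1; rewrite e2 mulrBl mul1r in le_mu; lra.
have s1 : 1 <= s by rewrite ler_ndivlMr // mul1r ler_ln ?posrE // ltW.
rewrite leNgt; apply/negP => Uq.
have := mu_shadow_small k0 kn Fk s1 (ltW Uq).
apply/negP; rewrite -ltNge -ps.
have -> : p = q * (k%:R / k.+1%:R) by rewrite /q /p; field; rewrite !gt_eqF.
by rewrite [ltRHS]powRM ?divr_ge0 ?(ltW q0) // ltr_pM2r // powR_gt0 // divr_gt0 ?ltr0n.
Qed.

End Shadows.

(** * Iteration up to layer l, and the extremal families *)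

Section Iterated.
Variables (R : realType) (n : nat).
Implicit Types (F : {set {set 'I_n}}) (k l : nat).
Local Notation mu := (mu R).

Lemma mu_mono k F1 F2 : F1 \subset F2 -> mu k F1 <= mu k F2.
Proof. by move=> F12; rewrite ler_wpM2r ?invr_ge0 // ler_nat subset_leq_card. Qed.

Lemma upper_shadowS l1 l2 F :
  upper_shadow l2 (upper_shadow l1 F) \subset upper_shadow l2 F.
Proof.
apply/subsetP => B; rewrite !inE => /andP[-> /exists_inP[A + AB]] /=.
rewrite inE => /andP[_ /exists_inP[A' A'F A'A]].
by apply/exists_inP; exists A' => //; apply: subset_trans AB.
Qed.

Lemma sub_upper_shadow k F : F \subset layer n k -> F \subset upper_shadow k F.
Proof.
move=> /subsetP Fk; apply/subsetP => A AF; rewrite inE Fk //=.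
by apply/exists_inP; exists A.
Qed.

Lemma density_itv k : (0 < k < n)%N -> 0 < (k%:R / n%:R : R) < 1.
Proof.
move=> /andP[k0 kn]; have nR : (0 : R) < n%:R by rewrite ltr0n (leq_trans _ kn).
apply/andP; split; first by rewrite divr_gt0 // ltr0n.
by rewrite ltr_pdivrMr // mul1r ltr_nat.
Qed.

Lemma ln_density_lt0 k : (0 < k < n)%N -> ln (k%:R / n%:R : R) < 0.
Proof. by move=> /density_itv; exact: ln_lt0. Qed.

Lemma exponent_gt0 k l : (0 < k < n)%N -> (0 < l < n)%N ->
  0 < ln (l%:R / n%:R : R) / ln (k%:R / n%:R).
Proof.
by move=> /ln_density_lt0 hk /ln_density_lt0 hl; rewrite -mulrNN -invrN divr_gt0 ?oppr_gt0.
Qed.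

Lemma mu_shadow_ge k l F : (0 < k <= l)%N -> (l < n)%N -> F \subset layer n k ->
  mu k F `^ (ln (l%:R / n%:R) / ln (k%:R / n%:R)) <= mu l (upper_shadow l F).
Proof.
move=> /andP[k0 kl] ln_ Fk; have kn := leq_ltn_trans kl ln_.
elim: l => [|l IH] in kl ln_ *; first by move: kl; rewrite leqNgt k0.
have hk : (0 < k < n)%N by rewrite k0.
move: kl; rewrite leq_eqVlt => /predU1P[<-|kl].
  by rewrite divff ?lt_eqF ?ln_density_lt0 // powRr1 ?mu_ge0 // mu_mono ?sub_upper_shadow.
have l0 : (0 < l)%N := leq_trans k0 kl.
have hl : (0 < l < n)%N by rewrite l0 ltnW.
apply: le_trans (mu_mono _ (upper_shadowS l l.+1 F)).
apply: le_trans (mu_shadow_step R l0 ln_ (upper_shadow_sub l F)).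
have -> : ln (l.+1%:R / n%:R) / ln (k%:R / n%:R) = (ln (l%:R / n%:R) / ln (k%:R / n%:R)) *
    (ln (l.+1%:R / n%:R) / ln (l%:R / n%:R)) :> R.
  by field; rewrite !lt_eqF ?ln_density_lt0.
rewrite powRrM ge0_ler_powR ?nnegrE ?powR_ge0 ?mu_ge0 //.
  by rewrite ltW // exponent_gt0 ?hl.
by rewrite IH // ltnW.
Qed.

Lemma mu_star k (i : 'I_n) : (k <= n)%N -> mu k (star i (layer n k)) = k%:R / n%:R.
Proof.
move=> kn; have nR : (0 : R) < n%:R by rewrite ltr0n (leq_ltn_trans _ (ltn_ord i)).
have sub : star i (layer n k) \subset layer n k by apply/subsetP => A; rewrite inE => /andP[].
(* The sets avoiding i are easier to count: they are the k-subsets of the other n - 1 points. *)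
have cD : #|layer n k :\: star i (layer n k)| = 'C(n.-1, k).
  have -> : layer n k :\: star i (layer n k) =
      [set A : {set 'I_n} | A \subset [set~ i] & #|A| == k].
    apply/setP => A; rewrite !inE subsetC sub1set inE.
    by case: (#|A| == k); rewrite /= ?andbF ?andbT.
  by rewrite cards_draws cardsC1 card_ord.
have := card_layerD_mu R kn sub; rewrite cD => /(congr1 ( *%R n%:R)).
rewrite -natrM mul_bin_down natrM natrB // mulrA => /mulIf.
rewrite bin_neq0 // => /(_ isT) eq; apply: (mulfI (lt0r_neq0 nR)).
rewrite [RHS]mulrCA divff ?gt_eqF // mulr1.
lra.
Qed.

Lemma upper_shadow_star k l (i : 'I_n) :
  upper_shadow l (star i (layer n k)) \subset star i (layer n l).
Proof.
apply/subsetP => B; rewrite !inE => /andP[-> /exists_inP[A]].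
by rewrite !inE => /andP[_ iA] /subsetP/(_ _ iA).
Qed.

Lemma star_of_tight k F : (0 < k)%N -> (k.+1 < n)%N -> F \subset layer n k ->
  mu k F = k%:R / n%:R ->
  mu k.+1 (upper_shadow k.+1 F) <= k.+1%:R / n%:R ->
  exists i, F = star i (layer n k).
Proof.
case: k => // r _ rn Fr muF muS; set k := r.+1 in rn Fr muF muS *.
have kn := ltnW rn.
have nR : (0 : R) < n%:R by rewrite ltr0n (leq_trans _ kn).
have knR : k.+1%:R < n%:R :> R by rewrite ltr_nat.
have eqk : k.+1%:R = k%:R + 1 :> R by rewrite natr1.
have eqr : k%:R = r%:R + 1 :> R by rewrite natr1.
set G := layer n k :\: F.
have Gr A : A \in G -> #|A| = k by exact: in_layerD.
have cG : #|G|%:R = (1 - k%:R / n%:R) * 'C(n, k)%:R :> R.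
  by rewrite card_layerD_mu ?muF // ltnW.
have Gx : #|G|%:R * k`!%:R = falling (n%:R - 1) k :> R.
  rewrite cG -mulrA natr_bin_ffact; apply: (mulfI (lt0r_neq0 nR)).
  rewrite -fallingS fallingSr mulrA mulrBr mulr1 mulrCA divff ?gt_eqF // mulr1.
  by rewrite mulrC.
have rx : r%:R <= n%:R - 1 :> R by lra.
have deg : forall v, #|star v G| = 0%N \/
    #|star v G|%:R * r`!%:R = falling (n%:R - 1 - 1) r :> R.
  apply: cliques_bound_eq rx Gr _ _; first by rewrite Gx.
  have := subset_leq_card (layerD_shadow_cliques k F).
  rewrite -(ler_nat R) card_layerD_mu ?upper_shadow_sub // -/G => le.
  rewrite -(ler_pM2l (_ : 0 < k.+1%:R)) ?ltr0n // in le; apply: le_trans le.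
  rewrite mulrCA natr_mul_bin_left ?(ltnW kn) // cG !mulrA.
  rewrite ler_pM2r ?ltr0n ?bin_gt0 ?(ltnW kn) //.
  have -> : (n%:R - 1 - k%:R) * (1 - k%:R / n%:R) =
    (1 - k.+1%:R / n%:R) * (n%:R - k%:R) :> R by rewrite eqk; field; rewrite gt_eqF.
  by rewrite ler_pM2r; lra.
have f0 : 0 < falling (n%:R - 1 - 1 : R) r by apply: falling_gt0; lra.
(* If [G] has no set through i, then [F] contains the star of i, and the two have equal size. *)
have [/existsP[i /eqP Gi]|/existsPn noi] := boolP [exists i, #|star i G| == 0%N].
  exists i; apply/eqP; rewrite eq_sym eqEcard; apply/andP; split.
    apply/subsetP => A; rewrite inE => /andP[Ak iA]; apply/negPn/negP => AF.
    move/eqP: Gi; rewrite cards_eq0 => /eqP/setP/(_ A).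
    by move: Ak; rewrite !inE AF iA => ->.
  rewrite -(ler_nat R) (card_mu _ _ (ltnW kn)) [leRHS](card_mu _ _ (ltnW kn)).
  by rewrite muF mu_star // ltnW.
(* If every degree were positive, the degree sum would be n C(n - 2, r), whereas k times the size
   C(n - 1, k) of [G] is (n - 1) C(n - 2, r). *)
have := sum_card_star Gr => /(congr1 (fun m => m%:R * r`!%:R : R)).
rewrite natr_sum mulr_suml (eq_bigr (fun=> falling (n%:R - 1 - 1) r)); last first.
  by move=> v _; case: (deg v) => // dv; move: (noi v); rewrite dv eqxx.
rewrite sumr_const card_ord -[LHS]mulr_natl natrM mulrAC -natrM -factS [RHS]mulrC Gx fallingS.
by move/(mulIf (lt0r_neq0 f0)); lra.
Qed.

End Iterated.

Theorem corollary1p4 (R : realType) (n k l : nat)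
    (hk : (1 <= k)%N) (hkl : (k <= l)%N) (hln : (l < n)%N)
    (F : {set {set 'I_n}}) (hF : F \subset layer n k) :
  let p : R := k%:R / n%:R in
  let q : R := l%:R / n%:R in
  mu R l (upper_shadow l F) >= mu R k F `^ (ln q / ln p) /\
  ((k < l)%N -> mu R k F = p ->
    (mu R l (upper_shadow l F) = mu R k F `^ (ln q / ln p) <->
     exists i : 'I_n, F = [set A in layer n k | i \in A])).
Proof.
move=> p q.
have hkn : (0 < k < n)%N by rewrite hk (leq_ltn_trans hkl).
have hlnn : (0 < l < n)%N by rewrite hln (leq_trans hk).
have main : mu R k F `^ (ln q / ln p) <= mu R l (upper_shadow l F).
  by apply: mu_shadow_ge; rewrite ?hk.
split=> // kl muF.
have pq : mu R k F `^ (ln q / ln p) = q.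
  by rewrite muF powR_ln_div ?density_itv //; case/andP: (density_itv R hlnn).
split=> [eq|[i eqF]]; last first.
  apply/le_anti; rewrite main andbT pq /q -(mu_star R i (ltnW hln)) mu_mono //.
  by rewrite eqF; exact: upper_shadow_star.
have k1n := leq_ltn_trans kl hln.
have hk1 : (0 < k.+1 < n)%N by [].
apply: (star_of_tight hk k1n hF muF).
(* A strict gain in layer k + 1 would survive the passage to layer l, because the remaining exponent
   is positive and sends (k + 1) / n to q. *)
rewrite leNgt; apply/negP => lt.
suff : q < mu R l (upper_shadow l F) by rewrite eq pq ltxx.
apply: lt_le_trans (mu_mono R _ (upper_shadowS k.+1 l F)).
apply: lt_le_trans (mu_shadow_ge R _ hln (upper_shadow_sub k.+1 F)); last by rewrite kl.
have /andP[q1 _] := density_itv R hk1.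
rewrite -{1}(@powR_ln_div R (k.+1%:R / n%:R) q) ?density_itv //; last first.
  by case/andP: (density_itv R hlnn).
by rewrite gt0_ltr_powR ?exponent_gt0 ?nnegrE ?mu_ge0 ?(ltW q1).
Qed.
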